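(* Let $t=\{t_k\}_{k=1}^\infty$ be a non-increasing sequence of positive numbers, $1\le q<\infty$ and $\varepsilon\ge 0$. Let $m\in\mathbb{Z}_+$ be such that $$1-\varepsilon^q\sum_{k=1}^m\frac{1}{t_k^q}\ge 0\qquad\text{and}\qquad 1-\varepsilon^q\sum_{k=1}^{m+1}\frac{1}{t_k^q}<0.$$ Then $$\mathcal{E}\left(W^T_q,I_{\varepsilon,\infty}\right)=\mathcal{E}\left(W^T_q,I_{\varepsilon,\infty},\Phi^*_m\right)=\left(t_{m+1}^q+\varepsilon^q\sum_{k=1}^m\left(1-\frac{t_{m+1}^q}{t_k^q}\right)\right)^{1/q}.$$
   Context: $\ell_q$ is the space of complex sequences $x=\{x_k\}_{k=1}^\infty$ with the usual norm $\|x\|_q$. The class is $W^T_q=\{x=Th : h\in\ell_q,\ \|h\|_q\le 1\}$, where $Th=\{t_kh_k\}_{k=1}^\infty$. $\mathbb{Z}_+=\{0,1,2,\ldots\}$ and $\sum_{k=1}^0 a_k:=0$. Let $Z$ be a complex linear space, $W\subset\ell_q$, and let $I$ be an information mapping assigning to each $x\in\ell_q$ a non-empty subset $I(x)\subset Z$. A method of recovery is an arbitrary mapping $\Phi:Z\to\ell_q$. Its error is $\mathcal{E}(W,I,\Phi)=\sup_{x\in W}\sup_{a\in I(x)}\|x-\Phi(a)\|_q$, and the error of optimal recovery is $\mathcal{E}(W,I)=\inf_{\Phi}\mathcal{E}(W,I,\Phi)$, the infimum being over all methods $\Phi:Z\to\ell_q$. Here $Z=\ell_\infty$ and $I_{\varepsilon,\infty}(x)=\{a\in\ell_\infty:\|x-a\|_\infty\le\varepsilon\}$.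 For $m\ge1$, $$\Phi^*_m(a)=\left(a_1\Big(1-\frac{t_{m+1}^q}{t_1^q}\Big),\ldots,a_m\Big(1-\frac{t_{m+1}^q}{t_m^q}\Big),0,0,\ldots\right),$$ and $\Phi^*_0(a)$ is the zero sequence. *)

(* Defs.v *)
From HB Require Import structures.
From mathcomp Require Import all_boot all_order all_algebra.
From mathcomp Require Import all_classical all_reals all_analysis.
From mathcomp Require Import finmap ess_sup_inf.
From mathcomp Require Import complex.

Set Implicit Arguments.
Unset Strict Implicit.
Unset Printing Implicit Defensive.

Import Order.TTheory GRing.Theory Num.Theory.
Import numFieldNormedType.Exports.
Import Normc.

Local Open Scope classical_set_scope.
Local Open Scope ring_scope.
Local Open Scope complex_scope.

(* Sequences are indexed from 0: the k-th term of the mathematical text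
   (k >= 1) is the value at k.-1. In particular t_{m+1} is [t m] and
   \sum_{k=1}^m is [\sum_(k < m)]. *)

(* The scalar type is R[i]^o, i.e. R[i] seen as a module over itself, so that
   sequences form an lmodType over R[i] for the pointwise operations. *)
Definition cseq (R : realType) := nat -> R[i]^o.

(* [normc] is the real-valued modulus, whereas the norm of the numDomainType
   R[i] takes its values in R[i]. See [seq_norm_fin] and [seq_norm_y] below for
   the explicit formulas. *)
Definition seq_norm {R : realType} (p : \bar R) (x : cseq R) : \bar R :=
  ('N[counting]_p[(fun k => (normc (x k))%:E)])%E.

Section seq_norm_lemmas.
Context {R : realType}.
Implicit Types (p : \bar R) (x y : cseq R).

Let counting_gt0 : (0 < @counting nat R [set: nat])%E.
Proof. by rewrite /counting asboolF ?ltey//; exact: infinite_nat. Qed.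

Lemma normc_ge0 (z : R[i]) : 0 <= normc z.
Proof. by case: z => a b; exact: sqrtr_ge0. Qed.

Lemma seq_norm_fin (q : R) x : 0 < q ->
  seq_norm q%:E x = ((\sum_(k <oo) (normc (x k) `^ q)%:E) `^ q^-1)%E.
Proof.
move=> q0; rewrite /seq_norm Lnorm_counting//; congr (_ `^ _)%E.
by apply: eq_eseriesr => k _; rewrite gee0_abs ?lee_fin ?normc_ge0.
Qed.

Lemma seq_norm_y x :
  seq_norm +oo%E x = ereal_sup (range (fun k => (normc (x k))%:E)).
Proof.
rewrite /seq_norm unlock /Lnorm counting_gt0; apply/eqP; rewrite eq_le.
apply/andP; split.
- apply/ess_supP; apply: nearW => k /=.
  rewrite ger0_norm ?normc_ge0//; apply: ereal_sup_ubound; by exists k.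
- apply: ub_ereal_sup => _ [k _ <-].
  have [N [_ N0 subN]] := ess_sup_ge (@counting nat R)
    (abse \o (fun k => (normc (x k))%:E)).
  apply: contrapT => nle; have Nk : N k.
    apply: subN => /=; by rewrite ger0_norm ?normc_ge0.
  have : (@counting nat R [set k] <= counting N)%E.
    by apply: le_measure; [exact: mem_set|exact: mem_set|move=> _ ->].
  rewrite N0 /counting; case: asboolP => [f|]; last by rewrite leye_eq.
  by rewrite fset_set1 cardfs1 lee_fin ler10.
Qed.

Lemma seq_norm_ge0 p x : (0 <= seq_norm p x)%E.
Proof. exact: Lnorm_ge0. Qed.

Let le_poweR (a b : \bar R) (r : R) : 0 <= r -> (0 <= a)%E -> (a <= b)%E ->
  (a `^ r <= b `^ r)%E.
Proof.
move=> r0 a0 ab; apply: gt0_ler_poweR => //; rewrite in_itv/= leey andbT//.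
exact: le_trans ab.
Qed.

Lemma le_seq_norm p x y : (1 <= p)%E ->
  (forall k, normc (x k) <= normc (y k)) -> (seq_norm p x <= seq_norm p y)%E.
Proof.
case: p => [q| |//] q1 xy.
  have q0 : 0 < q by rewrite (lt_le_trans ltr01).
  rewrite !seq_norm_fin//; apply: le_poweR; first by rewrite invr_ge0 ltW.
    by apply: nneseries_ge0 => k _ _; rewrite lee_fin powR_ge0.
  apply: lee_nneseries => k _; rewrite lee_fin ?powR_ge0//.
  by rewrite ge0_ler_powR ?nnegrE ?normc_ge0// ltW.
rewrite !seq_norm_y; apply: ub_ereal_sup => _ [k _ <-].
apply: (@le_trans _ _ (normc (y k))%:E); first by rewrite lee_fin.
by apply: ereal_sup_ubound; exists k.
Qed.

Lemma le_normc_seq_norm p x k : (1 <= p)%E ->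
  ((normc (x k))%:E <= seq_norm p x)%E.
Proof.
case: p => [q| |//] q1; last first.
  by rewrite seq_norm_y; apply: ereal_sup_ubound; exists k.
have q0 : 0 < q by rewrite (lt_le_trans ltr01).
rewrite seq_norm_fin//.
rewrite [leLHS](_ : _ = (((normc (x k)) `^ q)%:E `^ q^-1)%E); last first.
  by rewrite poweR_EFin -powRrM mulfV ?gt_eqF// powRr1 ?normc_ge0.
apply: le_poweR; [by rewrite invr_ge0 ltW|by rewrite lee_fin powR_ge0|].
have x0 n : (0 <= (normc (x n) `^ q)%:E)%E by rewrite lee_fin powR_ge0.
apply: le_trans (@nneseries_lim_ge _ _ xpredT 0 k.+1 _) => //.
by rewrite big_nat_recr//= leeDr// sume_ge0.
Qed.

Lemma seq_norm0 p : (1 <= p)%E -> seq_norm p (0 : cseq R) = 0%E.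
Proof.
move=> p1; rewrite /seq_norm -[RHS](@Lnorm0 _ _ _ (@counting nat R) p).
  by apply: eq_Lnorm => k; congr EFin; exact: (@normc0 R).
by rewrite gt_eqF// (lt_le_trans _ p1).
Qed.

Lemma seq_normD p x y : (1 <= p)%E ->
  (seq_norm p (x + y)%R <= seq_norm p x + seq_norm p y)%E.
Proof.
move=> p1.
apply: (@le_trans _ _ (seq_norm p (fun k => (normc (x k) + normc (y k))%:C))).
  apply: le_seq_norm => // k.
  rewrite [normc (_%:C)]/normc /= expr0n addr0 sqrtr_sqr ger0_norm.
    exact: le_normcD.
  by rewrite addr_ge0 ?normc_ge0.
apply: le_trans (@eminkowski _ _ _ (@counting nat R)
  (fun k => normc (x k)) (fun k => normc (y k)) p _ _ p1) => //.
rewrite /seq_norm (@eq_Lnorm _ _ _ _ _ _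
  (EFin \o ((fun k => normc (x k)) \+ (fun k => normc (y k)))))// => k /=.
by rewrite expr0n addr0 sqrtr_sqr ger0_norm// addr_ge0 ?normc_ge0.
Qed.

Lemma seq_normZ p (c : R[i]) x : (1 <= p)%E ->
  seq_norm p (c *: x) = ((normc c)%:E * seq_norm p x)%E.
Proof.
case: p => [q| |//] q1; last first.
  rewrite /seq_norm unlock /Lnorm counting_gt0 -ess_supZl// ?normc_ge0//.
  apply/eq_ess_sup/nearW => k /=.
  by rewrite (normcM c) !ger0_norm ?mulr_ge0 ?normc_ge0// EFinM.
have q0 : 0 < q by rewrite (lt_le_trans ltr01).
have s0 : (0 <= \sum_(k <oo) (normc (x k) `^ q)%:E)%E.
  by apply: nneseries_ge0 => k _ _; rewrite lee_fin powR_ge0.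
rewrite !seq_norm_fin//.
under eq_eseriesr do rewrite (normcM c) powRM ?normc_ge0// EFinM.
rewrite nneseriesZl; last first.
  by move=> k _; rewrite lee_fin powR_ge0.
rewrite poweRM ?lee_fin ?powR_ge0// poweR_EFin -powRrM mulfV ?gt_eqF//.
by rewrite powRr1 ?normc_ge0.
Qed.

End seq_norm_lemmas.

Section ellp.
Context {R : realType} {p : \bar R} (p1 : (1 <= p)%E).

(* The unused proof of 1 <= p is what allows the predicate, hence [ellp], to
   carry its submodule structure. *)
Definition in_ellp of (1 <= p)%E : {pred cseq R} :=
  mem [set x | (seq_norm p x < +oo)%E].

Record ellp := Ellp { ellp_seq :> nat -> R[i]^o; _ : ellp_seq \in in_ellp p1 }.

HB.instance Definition _ := [isSub for ellp_seq].
HB.instance Definition _ := [Choice of ellp by <:].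

Lemma in_ellpE x : (x \in in_ellp p1) = (seq_norm p x < +oo)%E.
Proof. exact/asboolP/idP. Qed.

Lemma ellp_submod_closed : submod_closed (in_ellp p1).
Proof.
split; first by rewrite in_ellpE seq_norm0.
move=> a x y; rewrite !in_ellpE => xfin yfin.
apply: (le_lt_trans (seq_normD _ _ p1)).
rewrite seq_normZ// lte_add_pinfty// lte_mul_pinfty ?lee_fin//.
exact: normc_ge0.
Qed.

HB.instance Definition _ :=
  GRing.isSubmodClosed.Build _ _ (in_ellp p1) ellp_submod_closed.
HB.instance Definition _ := [SubChoice_isSubLmodule of ellp by <:].

Lemma ellp_fin (x : ellp) : (seq_norm p x < +oo)%E.
Proof. by rewrite -in_ellpE; exact: valP. Qed.

Definition ellp_norm (x : ellp) : \bar R := seq_norm p x.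

End ellp.

Definition linfty (R : realType) := ellp (leey (1 : \bar R)).

Section optimal_recovery.
Context {R : realType} {p : \bar R} {p1 : (1 <= p)%E} {Z : lmodType R[i]}.
Implicit Types (W : set (ellp p1)) (I : ellp p1 -> set Z) (Phi : Z -> ellp p1).

(* Errors are extended reals, since the suprema may be infinite. *)
Definition method_error W I Phi : \bar R :=
  ereal_sup [set ereal_sup [set ellp_norm (x - Phi a) | a in I x] | x in W].

Definition optimal_error W I : \bar R :=
  ereal_inf (range (method_error W I)).

End optimal_recovery.

Section problem.
Context {R : realType} {q : R} (q1 : (1 <= q%:E)%E).
Implicit Types (t : nat -> R) (eps : R) (m : nat).

Definition class_W t : set (ellp q1) :=
  [set x | exists2 h : ellp q1, (ellp_norm h <= 1)%E &
           forall k, x k = (t k)%:C * h k].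

(* The difference is taken in the space of all sequences, because x and a
   belong to different spaces; [info_ball_neq0] shows that this is an
   information mapping, i.e. that its values are non-empty. *)
Definition info_ball eps (x : ellp q1) : set (linfty R) :=
  [set a | (seq_norm +oo (ellp_seq x - ellp_seq a)%R <= eps%:E)%E].

Lemma info_ball_neq0 eps x : 0 <= eps -> info_ball eps x !=set0.
Proof.
move=> eps0; have xfin : (x : cseq R) \in in_ellp (leey 1).
  rewrite in_ellpE; apply: le_lt_trans (ellp_fin x).
  rewrite seq_norm_y; apply: ub_ereal_sup => _ [k _ <-].
  exact: le_normc_seq_norm.
by exists (Ellp xfin); rewrite /info_ball/= subrr seq_norm0 ?leey// lee_fin.
Qed.

(* With the 0-based indexing, [t m] is t_{m+1}; for m = 0 this is the zero
   sequence. *)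
Definition Phi_star_seq t m (a : cseq R) : cseq R := fun k =>
  if (k < m)%N then (1 - t m `^ q / t k `^ q)%:C * a k else 0.

Lemma Phi_star_subproof t m (a : cseq R) : Phi_star_seq t m a \in in_ellp q1.
Proof.
rewrite in_ellpE seq_norm_fin ?(lt_le_trans ltr01)//; apply: poweR_lty.
rewrite (nneseries_split 0 m); last by move=> k _; rewrite lee_fin powR_ge0.
rewrite add0n eseries0 ?adde0; last first.
  move=> k mk _; rewrite /Phi_star_seq ltnNge mk /=.
  rewrite -[LHS]/((normc (0 : R[i]) `^ q)%:E) normc0 powR0//.
  by rewrite gt_eqF// (lt_le_trans ltr01).
by rewrite sumEFin ltry.
Qed.

Definition Phi_star t m (a : linfty R) : ellp q1 :=
  Ellp (Phi_star_subproof t m a).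

End problem.

Arguments class_W {R q} q1 t _.
Arguments info_ball {R q q1} eps x _.
Arguments Phi_star {R q} q1 t m a.

(* Main.v *)
Require Import Defs.
From mathcomp Require Import all_boot all_order all_algebra.
From mathcomp Require Import all_classical all_reals all_analysis.
From mathcomp Require Import complex.

Import Order.TTheory GRing.Theory Num.Theory.
Import numFieldNormedType.Exports.
Import Normc.

Local Open Scope classical_set_scope.
Local Open Scope ring_scope.
Local Open Scope complex_scope.

(** Write lambda_k = t_m^q / t_k^q (indices start at 0), which lies in (0, 1]
    for k <= m because t is non-increasing.

    Upper bound. Let x = T h with h in the unit ball, and let a be a datum with
    |x_k - a_k| <= eps. The error of [Phi_star] at a coordinate k < m is the
    convex combination
      x_k - (1 - lambda_k) a_k = lambda_k x_k + (1 - lambda_k) (x_k - a_k),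
    so convexity of s |-> s^q bounds its q-th power by
      t_m^q |h_k|^q + (1 - lambda_k) eps^q
    (lambda_k was chosen to turn t_k^q into t_m^q). At a coordinate k >= m the
    error is x_k itself, and |x_k|^q <= t_m^q |h_k|^q. Summing and using
    ||h||_q <= 1 gives [method_error_Phi_star_le].

    Lower bound. If x and -x both lie in the class and admit the same datum,
    no method can tell them apart, hence by the triangle inequality every
    method has error at least ||x||_q ([ellp_norm_le_optimal_error]). The datum
    is 0, and x is built greedily: x_k = eps for k < m, which by the first
    hypothesis on m costs at most the whole budget ||h||_q^q <= 1, and the
    remaining budget r = 1 - eps^q sum_{k<m} t_k^-q is spent on coordinate m.
    The second hypothesis on m says that this last coordinate is smaller than
    eps, so 0 is a datum for both x and -x. The norm of x is
      m eps^q + t_m^q r = t_m^q + eps^q sum_{k<m} (1 - lambda_k),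
    which is the q-th power of the upper bound ([exists_extremal]). *)

(** * Convexity of powers of the modulus *)

Lemma normc_real (R : realType) (r : R) : 0 <= r -> normc r%:C = r.
Proof. by move=> r0; rewrite /normc /= expr0n addr0 sqrtr_sqr ger0_norm. Qed.

Lemma powR_div (R : realType) (a b q : R) : 0 <= a -> 0 <= b ->
  (a / b) `^ q = a `^ q / b `^ q.
Proof.
move=> a0 b0; rewrite powRM ?invr_ge0//.
by rewrite -powR_inv1// -powRrM mulN1r powRN.
Qed.

Lemma powR_convex (R : realType) (q l a b : R) : 1 <= q -> 0 <= l <= 1 ->
  0 <= a -> 0 <= b ->
  (l * a + (1 - l) * b) `^ q <= l * a `^ q + (1 - l) * b `^ q.
Proof.
move=> q1 /andP[l0 l1] a0 b0.
have := @convex_powR R q q1 (Itv01 l0 l1) a b.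
by rewrite !convRE /=; apply; rewrite inE /= in_itv /= andbT.
Qed.

(** The shrunken datum (1 - l) a misses x by a convex combination of x and of
    the data error x - a, to which convexity of the q-th power applies. *)
Lemma normc_powR_shrink (R : realType) (q l : R) (x a : R[i]) :
  1 <= q -> 0 <= l <= 1 ->
  normc (x - (1 - l)%:C * a) `^ q <=
    l * normc x `^ q + (1 - l) * normc (x - a) `^ q.
Proof.
move=> q1 l01; have /andP[l0 l1] := l01.
apply: le_trans (powR_convex _ _ _ _ _ q1 l01 (normc_ge0 x) (normc_ge0 (x - a))).
rewrite ge0_ler_powR ?nnegrE ?normc_ge0 ?addr_ge0 ?mulr_ge0 ?subr_ge0 ?normc_ge0//.
  exact: le_trans q1.
have -> : x - (1 - l)%:C * a = l%:C * x + (1 - l)%:C * (x - a).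
  by rewrite mulrBr addrA -mulrDl -rmorphD /= (addrC l) subrK mul1r.
apply: le_trans (le_normcD _ _) _.
by rewrite !normcM !normc_real// subr_ge0.
Qed.

(** * Norms of sequences *)

(** Bounds on the l_q norm become bounds on a series, which can be proved term
    by term. *)
Lemma seq_norm_fin_le (R : realType) (q c : R) (x : cseq R) : 0 < q -> 0 <= c ->
  (seq_norm q%:E x <= (c `^ q^-1)%:E)%E =
  (\sum_(k <oo) (normc (x k) `^ q)%:E <= c%:E)%E.
Proof.
move=> q0 c0; rewrite seq_norm_fin//.
have s0 : (0 <= \sum_(k <oo) (normc (x k) `^ q)%:E)%E.
  by apply: nneseries_ge0 => k _ _; rewrite lee_fin powR_ge0.
case: (\sum_(k <oo) _)%E s0 => [s| |//] s0; last first.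
  by rewrite poweRyr ?invr_neq0 ?gt_eqF// !leye_eq.
rewrite poweR_EFin !lee_fin; rewrite lee_fin in s0.
have qV : 0 < q^-1 by rewrite invr_gt0.
apply/idP/idP => [|sc]; last by rewrite ge0_ler_powR// ltW.
by apply: contraTT; rewrite -!ltNge => cs; rewrite gt0_ltr_powR.
Qed.

Lemma seq_norm_fsupp (R : realType) (q : R) (x : cseq R) (n : nat) : 0 < q ->
  (forall k, (n <= k)%N -> x k = 0) ->
  seq_norm q%:E x = ((\sum_(k < n) normc (x k) `^ q) `^ q^-1)%:E.
Proof.
move=> q0 x0; rewrite seq_norm_fin// (nneseries_split 0 n); last first.
  by move=> k _; rewrite lee_fin powR_ge0.
rewrite add0n eseries0 ?adde0; last first.
  by move=> k nk _; rewrite x0// (normc0 R) powR0// gt_eqF.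
by rewrite sumEFin poweR_EFin big_mkord.
Qed.

(** * Indistinguishable pairs bound every method from below *)

(** The method returns the same element Phi a for x and for - x, and x is half
    the difference of the two errors x - Phi a and - x - Phi a. *)
Lemma ellp_norm_le_optimal_error (R : realType) (p : \bar R) (p1 : (1 <= p)%E)
    (Z : lmodType R[i]) (W : set (ellp p1)) (I : ellp p1 -> set Z)
    (x : ellp p1) (a : Z) :
  W x -> W (- x) -> I x a -> I (- x) a ->
  (ellp_norm x <= optimal_error W I)%E.
Proof.
move=> Wx WNx Ixa INxa; apply: le_ereal_inf_tmp => _ [Phi _ <-].
set E := method_error W I Phi.
have le_E y : W y -> I y a -> (ellp_norm (y - Phi a)%R <= E)%E.
  move=> Wy Iya; apply: le_trans (ereal_sup_ubound _); last by exists y.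
  by apply: ereal_sup_ubound; exists a.
have normZ (c : R[i]) (y : ellp p1) :
  ellp_norm (c *: y)%R = ((normc c)%:E * ellp_norm y)%E by exact: seq_normZ.
have normD (y z : ellp p1) : (ellp_norm (y + z)%R <= ellp_norm y + ellp_norm z)%E.
  exact: seq_normD.
have half0 : 0 <= 2^-1 :> R by rewrite invr_ge0.
have -> : x = (2^-1)%:C *: (x - Phi a) + (- (2^-1)%:C) *: (- x - Phi a).
  rewrite scaleNr -scalerBr opprB opprK subrKA -mulr2n -(scaler_nat 2 x) scalerA.
  by rewrite -(rmorph_nat (real_complex R)) -rmorphM /= mulVf ?pnatr_eq0// scale1r.
apply: le_trans (normD _ _) _; rewrite !normZ normcN normc_real//.
have -> : E = ((2^-1)%:E * E + (2^-1)%:E * E)%E.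
  rewrite -ge0_muleDl ?lee_fin// -EFinD.
  by rewrite [X in X%:E](_ : _ = 1) ?mul1e// [RHS]splitr mul1r.
by apply: leeD; apply: lee_wpmul2l; rewrite ?lee_fin//; exact: le_E.
Qed.

(** * The error of the shrinking method *)

Lemma normc_info_ball (R : realType) (q : R) (q1 : (1 <= q%:E)%E) (eps : R)
    (x : ellp q1) (a : linfty R) :
  info_ball eps x a <-> forall k, normc (x k - a k) <= eps.
Proof.
rewrite /info_ball /= seq_norm_y; split=> [xa k|xa].
  by rewrite -lee_fin; apply: le_trans xa; apply: ereal_sup_ubound; exists k.
by apply: ge_ereal_sup => _ [k _ <-]; rewrite lee_fin xa.
Qed.

(** Termwise, the q-th power of the error is at most t_m^q |h_k|^q + c_k, where
    c_k = eps^q (1 - t_m^q / t_k^q) for k < m and c_k = 0 afterwards. *)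
Lemma method_error_Phi_star_le (R : realType) (q : R) (q1 : (1 <= q%:E)%E)
    (t : nat -> R) (eps : R) (m : nat) :
  (forall k, 0 < t k) -> (forall j k, (j <= k)%N -> t k <= t j) ->
  (method_error (class_W q1 t) (info_ball eps) (Phi_star q1 t m) <=
    ((t m `^ q + eps `^ q * \sum_(k < m) (1 - t m `^ q / t k `^ q))
       `^ q^-1)%:E)%E.
Proof.
move=> t0 tle.
have q1' : 1 <= q by rewrite -lee_fin.
have q0 : 0 < q by exact: lt_le_trans q1'.
have tq0 k : 0 < t k `^ q by rewrite powR_gt0.
have tqle j k : (j <= k)%N -> t k `^ q <= t j `^ q.
  by move=> jk; rewrite ge0_ler_powR ?nnegrE ?tle// ltW.
have l01 k : (k < m)%N -> 0 <= t m `^ q / t k `^ q <= 1.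
  move=> km; rewrite divr_ge0 ?powR_ge0//= ler_pdivrMr// mul1r.
  exact/tqle/ltnW.
pose c k := if (k < m)%N then eps `^ q * (1 - t m `^ q / t k `^ q) else 0.
have c0 k : 0 <= c k.
  rewrite /c; case: ifPn => // km; rewrite mulr_ge0 ?powR_ge0// subr_ge0.
  by case/andP: (l01 k km).
have cE : (\sum_(k <oo) (c k)%:E)%E =
    (eps `^ q * \sum_(k < m) (1 - t m `^ q / t k `^ q))%:E.
  rewrite (nneseries_split 0 m); last by move=> k _; rewrite lee_fin.
  rewrite add0n eseries0 ?adde0; last first.
    by move=> k mk _; rewrite /c ltnNge mk.
  rewrite sumEFin big_mkord mulr_sumr; congr EFin.
  by apply: eq_bigr => k _; rewrite /c ltn_ord.
have s0 : 0 <= eps `^ q * \sum_(k < m) (1 - t m `^ q / t k `^ q).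
  by rewrite -lee_fin -cE nneseries_ge0// => k _ _; rewrite lee_fin.
apply: ge_ereal_sup => _ [x [h h1 xE] <-].
apply: ge_ereal_sup => _ [a /normc_info_ball xa <-].
rewrite /ellp_norm seq_norm_fin_le ?addr_ge0 ?powR_ge0//.
have sum_h : (\sum_(k <oo) (normc (h k) `^ q)%:E <= 1)%E.
  by rewrite -seq_norm_fin_le// powR1.
apply: (@le_trans _ _
    (\sum_(k <oo) ((t m `^ q)%:E * (normc (h k) `^ q)%:E + (c k)%:E))%E).
  apply: lee_nneseries => [k _ _|k _]; first by rewrite lee_fin powR_ge0.
  rewrite -EFinM -EFinD lee_fin.
  have xkE : normc (x k) `^ q = t k `^ q * normc (h k) `^ q.
    by rewrite xE normcM normc_real ?powRM ?normc_ge0// ltW.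
  rewrite -[normc _]/(normc (x k - Phi_star_seq t m a k)) /Phi_star_seq /c.
  case: ifPn => [km|]; last first.
    rewrite -leqNgt => mk; rewrite subr0 addr0 xkE.
    by rewrite ler_wpM2r ?powR_ge0// tqle.
  apply: le_trans (normc_powR_shrink _ _ _ _ _ q1' (l01 _ km)) _.
  rewrite xkE mulrA divfK ?gt_eqF// lerD2l mulrC.
  apply: ler_wpM2r; first by rewrite subr_ge0; case/andP: (l01 k km).
  have := xa k; rewrite ge0_ler_powR ?nnegrE ?normc_ge0//.
    exact: ltW.
  exact: le_trans (normc_ge0 _) (xa k).
rewrite nneseriesD; last 2 first.
- by move=> k _ _; rewrite -EFinM lee_fin mulr_ge0 ?powR_ge0.
- by move=> k _ _; rewrite lee_fin.
rewrite nneseriesZl; last by move=> k _; rewrite lee_fin powR_ge0.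
rewrite cE EFinD leeD2r// -[leRHS]mule1.
by apply: lee_wpmul2l => //; rewrite lee_fin powR_ge0.
Qed.

(** * The extremal element and the optimal error *)

Lemma finsupp_in_ellp (R : realType) (q : R) (q1 : (1 <= q%:E)%E)
    (x : cseq R) (n : nat) :
  (forall k, (n <= k)%N -> x k = 0) -> x \in in_ellp q1.
Proof.
move=> x0; rewrite in_ellpE (seq_norm_fsupp _ _ _ n) ?ltry//.
exact: lt_le_trans ltr01 _.
Qed.

Lemma class_WN (R : realType) (q : R) (q1 : (1 <= q%:E)%E) (t : nat -> R)
  (x : ellp q1) : class_W q1 t x -> class_W q1 t (- x).
Proof.
move=> [h h1 xE]; exists (- h) => [|k].
  rewrite /ellp_norm -scaleN1r (seq_normZ _ _ q1) ?normcN ?(normc1 R) ?mul1e//.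
by rewrite -[LHS]/(- x k) -[in RHS]/(- h k) xE mulrN.
Qed.

(** The element that is hardest to recover: the first m coordinates are as
    large as the data error can hide, and coordinate m uses up what is left of
    the constraint on h. *)
Lemma exists_extremal (R : realType) (q : R) (q1 : (1 <= q%:E)%E)
    (t : nat -> R) (eps : R) (m : nat) :
  (forall k, 0 < t k) -> 0 <= eps ->
  0 <= 1 - eps `^ q * \sum_(k < m) (t k `^ q)^-1 ->
  1 - eps `^ q * \sum_(k < m.+1) (t k `^ q)^-1 < 0 ->
  exists x : ellp q1, [/\ class_W q1 t x, forall k, normc (x k) <= eps &
    ellp_norm x =
      ((t m `^ q + eps `^ q * \sum_(k < m) (1 - t m `^ q / t k `^ q))
         `^ q^-1)%:E].
Proof.
move=> t0 eps0 hm hm1.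
have q0 : 0 < q by rewrite -lte_fin (lt_le_trans _ q1)// lte_fin.
have qV0 : 0 <= q^-1 by rewrite invr_ge0 ltW.
have tq0 k : 0 < t k `^ q by rewrite powR_gt0.
set r := 1 - _ in hm.
pose s k := if (k < m)%N then eps / t k else if k == m then r `^ q^-1 else 0.
have s0 k : 0 <= s k.
  rewrite /s; case: ifP => _; first by rewrite divr_ge0// ltW.
  by case: ifP => _; rewrite ?powR_ge0.
have s_tail k : (m < k)%N -> s k = 0.
  by move=> mk; rewrite /s ltnNge ltnW//= gtn_eqF.
have s_lt (k : 'I_m) : s k `^ q = eps `^ q / t k `^ q.
  by rewrite /s ltn_ord powR_div// ltW.
have s_m : s m `^ q = r.
  by rewrite /s ltnn eqxx -powRrM mulVf ?gt_eqF// powRr1.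
pose h : cseq R := fun k => (s k)%:C.
pose y : cseq R := fun k => (t k * s k)%:C.
have h_tail k : (m < k)%N -> h k = 0 by move=> mk; rewrite /h s_tail.
have y_tail k : (m < k)%N -> y k = 0 by move=> mk; rewrite /y s_tail ?mulr0.
pose hl := Ellp (finsupp_in_ellp _ _ q1 h _ h_tail).
pose x := Ellp (finsupp_in_ellp _ _ q1 y _ y_tail).
have normc_x k : normc (x k) = t k * s k.
  by rewrite normc_real// mulr_ge0// ltW.
have normc_h k : normc (hl k) = s k by rewrite normc_real.
exists x; split.
- exists hl => [|k]; last by rewrite -rmorphM.
  rewrite /ellp_norm (seq_norm_fsupp _ _ _ m.+1)// lee_fin big_ord_recr.
  rewrite normc_h s_m (eq_bigr (fun k : 'I_m => eps `^ q * (t k `^ q)^-1)).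
    by rewrite -mulr_sumr /= subrKC powR1.
  by move=> k _; rewrite normc_h s_lt.
- move=> k; rewrite normc_x /s; case: ifPn => km.
    by rewrite mulrC divfK// gt_eqF.
  case: eqP => [->|_]; last by rewrite mulr0.
  (* hm1 says exactly that r < eps `^ q / t m `^ q, so the last coordinate
     t m * r `^ q^-1 still has modulus at most eps. *)
  rewrite -ler_pdivlMl// mulrC.
  have -> : eps / t m = (eps `^ q / t m `^ q) `^ q^-1.
    rewrite -powR_div ?(ltW (t0 m))// -powRrM mulfV ?gt_eqF// powRr1//.
    by rewrite divr_ge0// ltW.
  rewrite ge0_ler_powR ?nnegrE ?divr_ge0 ?powR_ge0//.
  move: hm1; rewrite big_ord_recr mulrDr opprD addrA -/r subr_lt0.
  exact: ltW.
- rewrite /ellp_norm (seq_norm_fsupp _ _ _ m.+1)// big_ord_recr.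
  rewrite normc_x powRM ?(ltW (t0 _))// s_m.
  rewrite (eq_bigr (fun=> eps `^ q)); last first.
    move=> k _; rewrite normc_x powRM ?(ltW (t0 _))// s_lt.
    by rewrite mulrC divfK// gt_eqF.
  rewrite /=; congr (_ `^ _)%:E; rewrite sumrB -mulr_sumr mulrBr /r mulrBr mulr1.
  rewrite addrCA; congr (_ + _).
  by rewrite mulrCA !sumr_const card_ord mulr_natr.
Qed.

Theorem theorem5 (R : realType) (t : nat -> R) (q : R) (q1 : (1 <= q%:E)%E)
    (eps : R) (m : nat)
    (t_gt0 : forall k, 0 < t k)
    (t_noninc : forall j k, (j <= k)%N -> t k <= t j)
    (eps_ge0 : 0 <= eps)
    (hm : 0 <= 1 - eps `^ q * \sum_(k < m) (t k `^ q)^-1)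
    (hm1 : 1 - eps `^ q * \sum_(k < m.+1) (t k `^ q)^-1 < 0) :
  optimal_error (class_W q1 t) (info_ball eps) =
    method_error (class_W q1 t) (info_ball eps) (Phi_star q1 t m) /\
  method_error (class_W q1 t) (info_ball eps) (Phi_star q1 t m) =
    ((t m `^ q + eps `^ q * \sum_(k < m) (1 - t m `^ q / t k `^ q))
       `^ q^-1)%:E.
Proof.
have upper := method_error_Phi_star_le _ _ q1 _ eps m t_gt0 t_noninc.
have opt : (optimal_error (class_W q1 t) (info_ball eps) <=
    method_error (class_W q1 t) (info_ball eps) (Phi_star q1 t m))%E.
  by apply: ereal_inf_lbound; exists (Phi_star q1 t m).
have [x [Wx x_eps xE]] := exists_extremal _ _ q1 _ _ _ t_gt0 eps_ge0 hm hm1.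
have lower : (ellp_norm x <= optimal_error (class_W q1 t) (info_ball eps))%E.
  apply: (@ellp_norm_le_optimal_error _ _ _ _ _ _ _ (0 : linfty R)) => //.
  - exact: class_WN.
  - by apply/normc_info_ball => k; rewrite -[(0 : linfty R) _]/(0 : R[i]) subr0.
  - apply/normc_info_ball => k; rewrite -[(0 : linfty R) _]/(0 : R[i]) subr0.
    by rewrite -[(- x) _]/(- x k) normcN.
rewrite xE in lower.
by split; apply/eqP; rewrite eq_le ?opt ?upper /= ?(le_trans upper)//
  (le_trans lower).
Qed.
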